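(* Let $l\in\mathbb{Z}^+$, and let $\lambda_s\in\mathbb{C}$, $\vec a_s=\langle a_{s1},\ldots,a_{sl}\rangle\in\mathbb{Z}^l$ and $\vec n_s=\langle n_{s1},\ldots,n_{sl}\rangle\in(\mathbb{Z}^+)^l$ for $s=1,\ldots,k$. Suppose that the function $w:\mathbb{Z}^l\to\mathbb{C}$, $$w(\vec x)=\sum_{s=1}^k\lambda_s[\![\vec n_s\mid\vec x-\vec a_s]\!],$$ is periodic modulo $\vec n_0=\langle n_{01},\ldots,n_{0l}\rangle\in(\mathbb{Z}^+)^l$. Let $\vec d=\langle d_1,\ldots,d_l\rangle\in(\mathbb{Z}^+)^l$ be such that $\vec d\nmid\vec n_0$ and $$I(\vec d)=\{1\le s\le k:\ \vec d\mid\vec n_s\}\neq\emptyset.$$ If $\sum_{s\in I(\vec d)}\frac{\lambda_s}{n_{s1}\cdots n_{sl}}\neq 0$, then $$|I(\vec d)|\ \ge\ \Big|\Big\{\Big\{\sum_{t=1}^l\frac{a_{st}}{d_t}\Big\}:\ s\in I(\vec d)\Big\}\Big|\ \ge\ \min_{\substack{0\le s\le k\\ \vec d\,\nmid\,\vec n_s}}\Big[\frac{d_t}{(d_t,n_{st})}\Big]_{1\le t\le l}\ \ge\ p(d_1\cdots d_l).$$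
   Context: $\mathbb{Z}^+=\{1,2,3,\ldots\}$. $\mathbb{Z}^l$ is the direct sum of $l$ copies of the ring $\mathbb{Z}$; for $\vec x,\vec y\in\mathbb{Z}^l$, $\vec x\mid\vec y$ means that $\vec y=\langle q_1x_1,\ldots,q_lx_l\rangle$ for some $\vec q\in\mathbb{Z}^l$ (componentwise divisibility). A function $\Psi:\mathbb{Z}^l\to\mathbb{C}$ is periodic modulo $\vec n\in\mathbb{Z}^l$ if $\Psi(\vec x)=\Psi(\vec y)$ whenever $\vec n\mid\vec x-\vec y$. For an assertion $P$, $[\![P]\!]=1$ if $P$ holds and $0$ otherwise. $[x_t]_{1\le t\le l}$ denotes the least common multiple of $x_1,\ldots,x_l$, and $(a,b)$ the greatest common divisor of $a$ and $b$. For a real number $x$, $\{x\}$ denotes its fractional part (in the displayed chain, the outer braces denote a set and the inner braces the fractional part). $p(m)$ denotes the least prime divisor of an integer $m>1$. The minimum is over indices $s\in\{0,1,\ldots,k\}$ (including $s=0$, i.e. $\vec n_0$) with $\vec d\nmid\vec n_s$. *)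

(* Defs.v *)
From mathcomp Require Import all_boot all_order all_algebra finmap.
From mathcomp Require Import complex reals.

Set Implicit Arguments.
Unset Strict Implicit.
Unset Printing Implicit Defensive.

Import Order.TTheory GRing.Theory Num.Theory.
Local Open Scope ring_scope.

Notation vecz l := {ffun 'I_l -> int}.

(* Divisibility in the ring Z^l, as a boolean; see dvdvP. *)
Definition dvdv (l : nat) (x y : vecz l) : bool :=
  [forall t, (x t %| y t)%Z].

Lemma dvdvP (l : nat) (x y : vecz l) :
  reflect (exists q : vecz l, y = [ffun t => q t * x t]) (dvdv x y).
Proof.
apply: (iffP forallP) => [dv | [q ->] t]; last by rewrite ffunE dvdz_mull.
by exists [ffun t => (y t %/ x t)%Z]; apply/ffunP => t; rewrite !ffunE divzK.
Qed.

Definition posv (l : nat) (x : vecz l) : Prop := forall t, 0 < x t.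

Definition periodic_mod (l : nat) (T : Type) (n : vecz l) (Psi : vecz l -> T) : Prop :=
  forall x y, dvdv n (x - y) -> Psi x = Psi y.

Definition frac_part (R : realType) (x : R) : R := x - (Num.floor x)%:~R.

(* The moduli n_0, ..., n_k are indexed by 'I_k.+1 and the residues
   a_1, ..., a_k by 'I_k, so that the modulus going with a s is
   n (lift ord0 s) and n_0 is n ord0. *)
Definition wfun (R : realType) (l k : nat) (lambda : 'I_k -> R[i])
    (a : 'I_k -> vecz l) (n : 'I_k.+1 -> vecz l) (x : vecz l) : R[i] :=
  \sum_(s < k) lambda s * (dvdv (n (lift ord0 s)) (x - a s))%:R.

Definition Iset (l k : nat) (n : 'I_k.+1 -> vecz l) (d : vecz l) : {set 'I_k} :=
  [set s | dvdv d (n (lift ord0 s))].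

Definition lcm_ratio (l : nat) (d n : vecz l) : nat :=
  \big[lcmn/1%N]_(t < l) `|(d t %/ gcdz (d t) (n t))%Z|%N.

(* When d does not divide n ord0, the arg min ranges over a nonempty set
   and its default index ord0 is admissible. *)
Definition min_lcm_ratio (l k : nat) (n : 'I_k.+1 -> vecz l) (d : vecz l) : nat :=
  lcm_ratio d (n [arg min_(s < ord0 | ~~ dvdv d (n s)) lcm_ratio d (n s)]%N).

(* Main.v *)
Require Import Defs.
From mathcomp Require Import all_boot all_order all_algebra finmap.
From mathcomp Require Import complex reals separable cyclic cyclotomic.

Set Implicit Arguments.
Unset Strict Implicit.
Unset Printing Implicit Defensive.

Import Order.TTheory GRing.Theory Num.Theory.
Local Open Scope ring_scope.

(** The proof compares Fourier coefficients. Put D = d_1 ... d_l, let zeta be a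
    primitive D-th root of unity, and let chi be the character of Z^l sending x
    to zeta ^ (D * sum_t x_t / d_t); it plays the role of
    exp (2 i pi sum_t x_t / d_t). Fix j with 0 < j < m, m being the minimum in
    the statement, and sum w chi^j over a box {0, ..., N - 1}^l whose side N is
    a common multiple of D and of all the n_st.

    If f is periodic modulo n, translating by n_t along the t-th axis leaves f
    unchanged and multiplies chi^j by a constant, which differs from 1 for some
    t as soon as the least common multiple of the d_t / (d_t, n_t) does not
    divide j; the sum of f chi^j then vanishes (sum_chiX_eq0). This applies to
    w, whose period n_0 is not a multiple of d, and to each residue class with
    d not dividing n_s, because 0 < j < m. When d divides n_s, on the contrary,
    chi is constant on the class of a_s, and the sum is
    N^l chi(a_s)^j / (n_s1 ... n_sl) (sum_residue_chiX). What remains is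

      sum_(s in I) c_s z_s^j = 0 for 0 < j < m,

    with c_s = lambda_s / (n_s1 ... n_sl) and z_s = chi(a_s), while the sum of
    the c_s is nonzero. Let P be a polynomial with P(0) <> 0 that vanishes at
    every z_s. Were its degree less than m, expanding sum_s c_s P(z_s) = 0
    would leave P(0) sum_s c_s = 0, which is absurd
    (leq_card_of_power_sums_eq0). Now z_s depends only on the fractional part
    of sum_t a_st / d_t, so P can be given one root per fractional part, and
    there are at least m of them.

    Finally the least common multiple attached to some n_s not divisible by d
    is a divisor of D other than 1, whence the lower bound p(D)
    (pdiv_le_lcm_ratio). *)

(** * Primitive roots of unity *)

Lemma closed_field_prim_root_exists (F : closedFieldType) (n : nat) :
  n%:R != 0 :> F -> exists z : F, n.-primitive_root z.
Proof.
move=> n_neq0; have n_gt0 : (0 < n)%N.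
  by case: n n_neq0 => //; rewrite eqxx.
have [r Dp] := closed_field_poly_normal ('X^n - 1 : {poly F}).
rewrite (monicP _) ?monicXnsubC // scale1r in Dp.
have rn1 : all n.-unity_root r by apply/allP=> z; rewrite -root_prod_XsubC -Dp.
have sz_r : (n <= size r)%N.
  by rewrite -ltnS -(size_prod_XsubC r id) -Dp size_XnsubC.
have r_uniq : uniq r by rewrite -separable_prod_XsubC -Dp separable_Xn_sub_1.
by have /hasP[z _ z_prim] := has_prim_root n_gt0 rn1 r_uniq sz_r; exists z.
Qed.

Lemma prim_root_neq0 (F : fieldType) (D : nat) (z : F) :
  D.-primitive_root z -> z != 0.
Proof.
move=> z_prim; apply/eqP => z0; have := prim_expr_order z_prim.
by rewrite z0 expr0n gtn_eqF ?(prim_order_gt0 z_prim) // => /esym/eqP; rewrite oner_eq0.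
Qed.

Lemma prim_orderz_dvd (F : fieldType) (D : nat) (z : F) (m : int) :
  D.-primitive_root z -> (z ^ m == 1) = (D %| m)%Z.
Proof.
move=> z_prim; rewrite dvdzE /= (prim_order_dvd z_prim).
by case: m => m //; rewrite NegzE abszN /= invr_eq1.
Qed.

(** * Vanishing power sums *)

(** A polynomial with nonzero constant term that kills all the z_i has degree at
    least m: otherwise the vanishing power sums would reduce its weighted sum of
    values to its constant term times the sum of the weights. The labels f i
    only serve to count the roots such a polynomial needs. *)
Lemma leq_card_of_power_sums_eq0 (F : fieldType) (K : choiceType) (I : finType)
    (A : {set I}) (c z : I -> F) (f : I -> K) (m : nat) :
  {in A &, forall i j, f i = f j -> z i = z j} ->
  {in A, forall i, z i != 0} ->
  (forall j, (0 < j < m)%N -> \sum_(i in A) c i * z i ^+ j = 0) ->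
  \sum_(i in A) c i != 0 ->
  (m <= #|` [fset f i | i in A]%fset|)%N.
Proof.
move=> zf z_neq0 sum0; apply: contraR; rewrite -ltnNge => lt_m.
set fA := [fset f i | i in A]%fset in lt_m.
(* The common value of z on a fibre of f; the default 1 only has to be nonzero. *)
pose h (y : K) := if [pick i in A | f i == y] is Some i then z i else 1.
have hf i : i \in A -> h (f i) = z i.
  rewrite /h => Ai; case: pickP => [j /andP[Aj /eqP/zf-> //]|/(_ i)].
  by rewrite Ai eqxx.
have h_neq0 y : h y != 0.
  by rewrite /h; case: pickP => [i /andP[/z_neq0] //|_]; apply: oner_neq0.
pose P := \prod_(y <- fA) ('X - (h y)%:P).
have P_root i : i \in A -> P.[z i] = 0.
  move=> Ai; have fAi : f i \in fA by apply: in_imfset.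
  apply/rootP; rewrite /P (big_rem (f i)) //= rootM hf //.
  by rewrite root_XsubC eqxx.
have P0 : P`_0 != 0.
  rewrite -horner_coef0 horner_prod prodf_seq_neq0; apply/allP => y _.
  by rewrite /= hornerXsubC sub0r oppr_eq0.
have szP : size P = #|` fA|.+1 by rewrite size_prod_XsubC.
rewrite -(inj_eq (mulfI P0)) mulr0; apply/eqP.
transitivity (\sum_(i in A) c i * P.[z i]); last first.
  by rewrite big1 // => i Ai; rewrite P_root ?mulr0.
transitivity (\sum_(j < size P) P`_j * \sum_(i in A) c i * z i ^+ j).
  rewrite szP big_ord_recl /= [X in _ + X]big1 ?addr0 => [|j _].
    by congr (_ * _); apply: eq_bigr => i _; rewrite expr0 mulr1.
  by rewrite sum0 ?mulr0 //= (leq_ltn_trans (ltn_ord j)).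
under eq_bigr do rewrite big_distrr /=.
rewrite exchange_big /=; apply: eq_bigr => i Ai.
rewrite horner_coef big_distrr /=; apply: eq_bigr => j _.
by rewrite mulrCA.
Qed.

(** * Divisibility and periodicity in Z^l *)

Lemma dvdv_trans (l : nat) (m n x : vecz l) : dvdv m n -> dvdv n x -> dvdv m x.
Proof.
move=> /forallP mn /forallP nx; apply/forallP => t.
exact: dvdz_trans (mn t) (nx t).
Qed.

Lemma periodic_mod_dvd (l : nat) (T : Type) (n N : vecz l) (f : vecz l -> T) :
  dvdv n N -> periodic_mod n f -> periodic_mod N f.
Proof. by move=> nN f_per x y /(dvdv_trans nN); apply: f_per. Qed.

Lemma dvdv_periodic (l : nat) (n a : vecz l) :
  periodic_mod n (fun x : vecz l => dvdv n (x - a)).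
Proof.
move=> x y /forallP nxy; apply: eq_forallb => t; have := nxy t; rewrite !ffunE.
by move=> nxyt; rewrite -(subrK (y t) (x t)) -addrA rpredDl.
Qed.

Lemma natr_forall (F : comNzRingType) (I : finType) (b : pred I) :
  [forall i, b i]%:R = \prod_i (b i)%:R :> F.
Proof.
case: forallP => [b_true | /forallP]; first by rewrite big1 // => i _; rewrite b_true.
rewrite negb_forall => /existsP[i /negPf b_false].
by rewrite (bigD1 i) //= b_false mul0r.
Qed.

(** * Sums over a box *)

Section Box.
Variables (l M : nat).

(** The box {0, ..., M}^l, read inside Z^l. Its coordinates live in 'I_M.+1, so
    that it is a finite group and translations of Z^l act on it by
    permutations. *)
Definition box_pt (x : {ffun 'I_l -> 'I_M.+1}) : vecz l :=
  [ffun t => (x t : nat)%:Z].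

Definition cubev : vecz l := [ffun=> M.+1%:Z].

(** Modulo the side of the box, translating Z^l by v is a bijection of the
    box. *)
Lemma sum_box_shift (V : nmodType) (f : vecz l -> V) (v : vecz l) :
  periodic_mod cubev f ->
  \sum_x f (box_pt x + v) = \sum_x f (box_pt x).
Proof.
move=> f_per; pose u : {ffun 'I_l -> 'I_M.+1} :=
  [ffun t => inord `|(v t %% M.+1)%Z|%N].
rewrite [RHS](reindex_inj (addIr u)) /=; apply: eq_bigr => x _.
apply: f_per; apply/forallP => t; rewrite !ffunE -eqz_mod_dvd /=.
have v_ge0 : 0 <= (v t %% M.+1)%Z by rewrite modz_ge0.
rewrite inordK; last first.
  by rewrite -ltz_nat gez0_abs // ltz_pmod.
by rewrite -modz_nat modz_mod PoszD gez0_abs // modzDmr.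
Qed.

(** By translation invariance the sum S satisfies S = c S. *)
Lemma sum_box_eq0 (F : idomainType) (f : vecz l -> F) (v : vecz l) (c : F) :
  periodic_mod cubev f -> (forall x, f (x + v) = c * f x) -> c != 1 ->
  \sum_x f (box_pt x) = 0.
Proof.
move=> f_per f_shift c_neq1; set S := \sum_x _.
have : (c - 1) * S = 0.
  rewrite mulrBl mul1r {1}/S big_distrr /=.
  by under eq_bigr do rewrite -f_shift; rewrite sum_box_shift // subrr.
by move/eqP; rewrite mulf_eq0 subr_eq0 (negPf c_neq1) => /eqP.
Qed.

Lemma sum_ord_dvd (n : nat) :
  (n %| M.+1)%N -> (\sum_(y < M.+1) (n %| y) * n)%N = M.+1.
Proof.
move=> n_dvd; rewrite -big_distrl /= -[RHS](divnK n_dvd); congr (_ * _)%N.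
rewrite divn_count_dvd big_add1 /= big_mkord.
by rewrite [LHS]big_ord_recl [RHS]big_ord_recr /= n_dvd dvdn0 addnC.
Qed.

(** A residue class modulo n fills a proportion 1 / (n_1 ... n_l) of the box: by
    translation its size does not depend on a, and for a = 0 the count is a
    product of one-dimensional counts of multiples. *)
Lemma sum_box_residue (F : comNzRingType) (n a : vecz l) :
  posv n -> dvdv n cubev ->
  (\sum_x (dvdv n (box_pt x - a))%:R) * (\prod_t n t)%:~R = (M.+1 ^ l)%:R :> F.
Proof.
move=> n_gt0 nM.
have f_per : periodic_mod cubev (fun x => (dvdv n (x - a))%:R : F).
  by apply: (periodic_mod_dvd nM) => x y nxy; rewrite (dvdv_periodic a nxy).
rewrite -(sum_box_shift a f_per).
have -> : (\prod_t n t)%:~R = (\prod_t `|n t|%N)%:R :> F.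
  rewrite natr_prod rmorph_prod; apply: eq_bigr => t _ /=.
  by rewrite -[in LHS](gtz0_abs (n_gt0 t)).
under [X in X * _]eq_bigr => x _.
  rewrite addrK (natr_forall F (fun t => (n t %| box_pt x t)%Z)).
  under eq_bigr => t _ do rewrite ffunE dvdzE /=.
  over.
rewrite -(bigA_distr_bigA (fun t (y : 'I_M.+1) => (`|n t|%N %| y)%N%:R)).
rewrite natr_prod -big_split /=.
under eq_bigr => t _.
  rewrite -natr_sum -natrM big_distrl /= sum_ord_dvd; last first.
    by move/forallP/(_ t): nM; rewrite ffunE dvdzE.
  over.
by rewrite prodr_const !card_ord natrX.
Qed.

End Box.

(** * The least common multiple of the d_t / (d_t, n_t) *)

(** lcm_ratio d n is the order of n in the quotient of Z^l by the multiples of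
    d. *)
Lemma lcm_ratio_dvdP (l : nat) (d n : vecz l) (j : nat) : posv d ->
  reflect (forall t, (d t %| j%:Z * n t)%Z) (lcm_ratio d n %| j)%N.
Proof.
move=> d_gt0; rewrite /lcm_ratio.
have ratioE t : (`|(d t %/ gcdz (d t) (n t))%Z| %| j)%N = (d t %| j%:Z * n t)%Z.
  have := d_gt0 t; case: (d t) => // q; rewrite ltz_nat => q_gt0.
  rewrite /gcdz divz_nat /= dvdzE abszM /= dvdn_divLR ?gcdn_gt0 ?dvdn_gcdl ?q_gt0 //.
  by rewrite muln_gcdr dvdn_gcd dvdn_mull.
by apply: (iffP (dvdn_biglcmP _ _ _)) => [h t|h t _]; have := h t; rewrite ratioE //; apply.
Qed.

Lemma lcm_ratio_eq1 (l : nat) (d n : vecz l) : posv d ->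
  (lcm_ratio d n == 1%N) = dvdv d n.
Proof.
move=> d_gt0; rewrite -dvdn1; apply/(lcm_ratio_dvdP n 1 d_gt0)/forallP => h t;
  by have := h t; rewrite mul1r.
Qed.

Lemma pdiv_le_lcm_ratio (l : nat) (d n : vecz l) : posv d -> ~~ dvdv d n ->
  (pdiv `|(\prod_t d t)%R| <= lcm_ratio d n)%N.
Proof.
move=> d_gt0; rewrite -lcm_ratio_eq1 // => ratio_neq1.
have ratio_dvd : (lcm_ratio d n %| `|(\prod_t d t)%R|)%N.
  apply/(lcm_ratio_dvdP n _ d_gt0) => t; rewrite dvdzE abszM absz_nat dvdn_mulr //.
  by rewrite (bigD1 t) //= abszM dvdn_mulr.
apply: (pdiv_min_dvd _ ratio_dvd).
have prod_gt0 : (0 < `|(\prod_t d t)%R|)%N by rewrite absz_gt0 gt_eqF ?prodr_gt0.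
by case: (lcm_ratio d n) (dvdn_gt0 prod_gt0 ratio_dvd) ratio_neq1 => [|[]].
Qed.

(** * Character sums *)

Section Character.
Variables (F : numFieldType) (l : nat) (d : vecz l) (z : F).
Hypothesis d_gt0 : posv d.
Let D := `|(\prod_t d t)%R|%N.
Hypothesis z_prim : D.-primitive_root z.

(** D * sum_t x_t / d_t, as an integer. *)
Definition phase (x : vecz l) : int := \sum_t x t * (\prod_t d t %/ d t)%Z.

Definition chi (x : vecz l) : F := z ^ phase x.

Let z_neq0 : z != 0 := prim_root_neq0 z_prim.

Let prod_gt0 : 0 < \prod_t d t.
Proof. by apply: prodr_gt0. Qed.

Let DE : D%:Z = \prod_t d t.
Proof. by rewrite /D gtz0_abs. Qed.

Let cofactorK t : (\prod_t d t %/ d t)%Z * d t = D%:Z.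
Proof. by rewrite DE divzK // (bigD1 t) //= dvdz_mulr. Qed.

Lemma chi_neq0 x : chi x != 0.
Proof. exact: expfz_neq0. Qed.

Lemma phaseD x y : phase (x + y) = phase x + phase y.
Proof. by rewrite -big_split; apply: eq_bigr => t _; rewrite ffunE mulrDl. Qed.

Lemma chiD x y : chi (x + y) = chi x * chi y.
Proof. by rewrite /chi phaseD expfzDr. Qed.

Lemma chiX x (j : nat) : chi x ^+ j = z ^ (j%:Z * phase x).
Proof. by rewrite mulrC -exprz_exp. Qed.

Lemma chi_eq x y : (D %| phase x - phase y)%Z -> chi x = chi y.
Proof.
rewrite -(prim_orderz_dvd _ z_prim) => /eqP zxy.
by rewrite /chi -(subrK (phase y) (phase x)) expfzDr // zxy mul1r.
Qed.

Lemma chi_periodic : periodic_mod d chi.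
Proof.
move=> x y /forallP dxy; apply: chi_eq.
rewrite -sumrB; apply: rpred_sum => t _.
have := dxy t; rewrite !ffunE => /dvdzP[q xyE].
rewrite -mulrBl xyE -mulrA [d t * _]mulrC cofactorK.
exact: dvdz_mull.
Qed.

Definition axisv (n : vecz l) (t : 'I_l) : vecz l :=
  [ffun u => if u == t then n t else 0].

Lemma phase_axisv n t : phase (axisv n t) = n t * (\prod_t d t %/ d t)%Z.
Proof.
rewrite /phase (bigD1 t) //= ffunE eqxx [X in _ + X]big1 ?addr0 // => u /negPf ut.
by rewrite ffunE ut mul0r.
Qed.

(** chi (axisv n t) is zeta ^ (n_t D / d_t), whose j-th power is 1 exactly when
    d_t divides j n_t. *)
Lemma chi_axisv_neq1 n j : ~~ (lcm_ratio d n %| j)%N ->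
  exists t, chi (axisv n t) ^+ j != 1.
Proof.
move=> ratio_ndvd; apply/existsP; apply: contraR ratio_ndvd => /existsPn chi1.
apply/(lcm_ratio_dvdP n j d_gt0) => t; have /negbNE := chi1 t.
rewrite chiX phase_axisv (prim_orderz_dvd _ z_prim) -(cofactorK t).
rewrite mulrA [X in (_ %| X)%Z]mulrC dvdz_mul2l //.
by apply/eqP => e0; have := cofactorK t; rewrite e0 mul0r DE => /eqP; rewrite lt_eqF.
Qed.

Variable M : nat.
Hypothesis dM : dvdv d (cubev l M).

(** The j-th Fourier coefficient of a function of period n vanishes unless chi^j
    is trivial on the multiples of n. *)
Lemma sum_chiX_eq0 (n : vecz l) (f : vecz l -> F) (j : nat) :
  dvdv n (cubev l M) -> periodic_mod n f -> ~~ (lcm_ratio d n %| j)%N ->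
  \sum_(x : {ffun 'I_l -> 'I_M.+1}) f (box_pt x) * chi (box_pt x) ^+ j = 0 :> F.
Proof.
move=> nM f_per /chi_axisv_neq1[t]; 
  apply: (sum_box_eq0 (f := fun x => f x * chi x ^+ j) (v := axisv n t)).
  move=> x y Mxy; rewrite (periodic_mod_dvd nM f_per Mxy).
  by rewrite (periodic_mod_dvd dM chi_periodic Mxy).
move=> x; rewrite chiD exprMn mulrA mulrC; congr (_ * (_ * _)).
apply: f_per; apply/forallP => u; rewrite addrC addKr ffunE.
by case: eqP => [->|_]; rewrite ?dvdz0.
Qed.

(** chi has period d, hence is constant on a residue class modulo a multiple
    of d. *)
Lemma sum_residue_chiX (n a : vecz l) (j : nat) :
  posv n -> dvdv n (cubev l M) -> dvdv d n ->
  \sum_(x : {ffun 'I_l -> 'I_M.+1})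
      (dvdv n (box_pt x - a))%:R * chi (box_pt x) ^+ j
    = (M.+1 ^ l)%:R / (\prod_t n t)%:~R * chi a ^+ j :> F.
Proof.
move=> n_gt0 nM dn; rewrite -(sum_box_residue F a n_gt0 nM) mulfK; last first.
  by rewrite intr_eq0 gt_eqF ?prodr_gt0.
rewrite big_distrl; apply: eq_bigr => x _ /=.
have [na|_] := boolP (dvdv n _); last by rewrite !mul0r.
by rewrite (chi_periodic (x := box_pt x) (y := a)) //; apply: dvdv_trans na.
Qed.

End Character.

(** * The theorem *)

Lemma frac_part_eq (R : realType) (x y : R) :
  frac_part x = frac_part y -> exists m : int, x = y + m%:~R.
Proof.
move=> xy; exists (Num.floor x - Num.floor y).
by rewrite rmorphB /= addrCA -/(frac_part y) -xy addrC subrK.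
Qed.

(** Links the fractional parts in the theorem to the exponents of chi. *)
Lemma phase_ratE (R : numFieldType) (l : nat) (d x : vecz l) : posv d ->
  \sum_t (x t)%:~R / (d t)%:~R = (phase d x)%:~R / (\prod_t d t)%:~R :> R.
Proof.
move=> d_gt0; rewrite rmorph_sum big_distrl /=; apply: eq_bigr => t _.
have dt_neq0 u : (d u)%:~R != 0 :> R by rewrite intr_eq0 gt_eqF.
have prod_neq0 : (\prod_u d u)%:~R != 0 :> R.
  by rewrite intr_eq0 gt_eqF ?prodr_gt0.
rewrite rmorphM /= -mulrA; congr (_ * _); apply: (mulIf prod_neq0).
have d_dvd : (d t %| \prod_u d u)%Z by rewrite (bigD1 t) //= dvdz_mulr.
by rewrite divfK // -[in LHS](divzK d_dvd) rmorphM /= mulrCA mulVf ?mulr1.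
Qed.

Local Open Scope fset_scope.

Theorem theorem1p4 (R : realType) (l k : nat) (lambda : 'I_k -> R[i])
    (a : 'I_k -> vecz l) (n : 'I_k.+1 -> vecz l) (d : vecz l)
    (hl : (0 < l)%N)
    (hn : forall s, posv (n s))
    (hw : periodic_mod (n ord0) (wfun lambda a n))
    (hd : posv d)
    (hd0 : ~~ dvdv d (n ord0))
    (hI : Iset n d != set0)
    (hsum : \sum_(s in Iset n d)
              lambda s / (\prod_(t < l) n (lift ord0 s) t)%:~R != 0) :
  let fracs : {fset R} :=
    [fset frac_part (\sum_(t < l) (a s t)%:~R / (d t)%:~R) | s in Iset n d] in
  [/\ (#|Iset n d| >= #|` fracs|)%N,
      (#|` fracs| >= min_lcm_ratio n d)%N
    & (min_lcm_ratio n d >= pdiv `|(\prod_(t < l) d t)%R|)%N].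
Proof.
set I := Iset n d => fracs.
have ratio_min : {s | min_lcm_ratio n d = lcm_ratio d (n s) & ~~ dvdv d (n s)
    /\ forall r, ~~ dvdv d (n r) -> (min_lcm_ratio n d <= lcm_ratio d (n r))%N}.
  rewrite /min_lcm_ratio; case: arg_minnP => // s ds s_min; by exists s.
case: ratio_min => s0 min_ratioE [ds0 min_ratio_le].
split; last by rewrite min_ratioE pdiv_le_lcm_ratio.
  by apply: leq_trans (leq_imfset_card _ _ _) _; rewrite cardE.
set D := `|(\prod_t d t)%R|%N.
have D_gt0 : (0 < D)%N by rewrite absz_gt0 gt_eqF ?prodr_gt0.
have [|z z_prim] := @closed_field_prim_root_exists R[i] D.
  by rewrite pnatr_eq0 -lt0n.
(* Side of the box: a common multiple of D and of all the moduli. *)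
pose N := (D * \prod_s \prod_t `|n s t|)%N.
have N_gt0 : (0 < N)%N.
  rewrite muln_gt0 D_gt0 prodn_gt0 // => s; rewrite prodn_gt0 // => t.
  by rewrite absz_gt0 gt_eqF ?hn.
pose M := N.-1.
have dM : dvdv d (cubev l M).
  apply/forallP => t; rewrite ffunE prednK // dvdzE /= dvdn_mulr //.
  by rewrite /D (bigD1 t) //= abszM dvdn_mulr.
have nM s : dvdv (n s) (cubev l M).
  apply/forallP => t; rewrite ffunE prednK // dvdzE /= dvdn_mull //.
  by rewrite (bigD1 s) //= (bigD1 t) //= !dvdn_mulr.
pose c s := lambda s / (\prod_t n (lift ord0 s) t)%:~R.
apply: (leq_card_of_power_sums_eq0 (c := c) (z := fun s => chi d z (a s))) => //.
- move=> s r _ _ /frac_part_eq[m].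
  rewrite !phase_ratE // => /(canRL (divfK _)) phaseE.
  apply: (chi_eq z_prim).
  have prod_neq0 : (\prod_t d t)%:~R != 0 :> R.
    by rewrite intr_eq0 gt_eqF ?prodr_gt0.
  move: (phaseE prod_neq0); rewrite mulrDl divfK // -rmorphM -rmorphD /=.
  move/intr_inj => ->; rewrite addrC addKr; apply: dvdz_mull.
  by rewrite dvdzE.
- by move=> s _; apply: chi_neq0 z_prim _.
move=> j /andP[j_gt0 j_lt].
have ratio_ndvd s : ~~ dvdv d (n s) -> ~~ (lcm_ratio d (n s) %| j)%N.
  move=> /min_ratio_le le_s; apply/negP => /(dvdn_leq j_gt0) le_j.
  by have := leq_trans j_lt (leq_trans le_s le_j); rewrite ltnn.
have coef0 := sum_chiX_eq0 hd z_prim dM (nM ord0) hw (ratio_ndvd _ hd0).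
(* Expand the vanishing coefficient of w along the residue classes. *)
have volume_neq0 : (M.+1 ^ l)%:R != 0 :> R[i] by rewrite pnatr_eq0 expn_eq0.
apply: (mulfI volume_neq0); rewrite mulr0 -[RHS]coef0 /wfun.
under [RHS]eq_bigr do rewrite big_distrl /=.
rewrite exchange_big /= [RHS](bigID (mem I)) /= [X in (_ + X)%R]big1 ?addr0.
  rewrite big_distrr /=; apply: eq_bigr => s; rewrite inE => ds.
  under eq_bigr do rewrite -mulrA.
  rewrite -big_distrr (sum_residue_chiX hd z_prim) //= /c.
  by rewrite mulrCA -!mulrA; congr (_ * _)%R; rewrite mulrCA.
move=> s; rewrite inE => ds; under eq_bigr do rewrite -mulrA.
rewrite -big_distrr.
rewrite (sum_chiX_eq0 (f := fun x => (dvdv (n (lift ord0 s)) (x - a s))%:R)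
  hd z_prim dM (nM (lift ord0 s))) /= ?mulr0 ?ratio_ndvd //.
by move=> x y nxy; rewrite (dvdv_periodic (a s) nxy).
Qed.
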